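(* Let $g\in\mathcal{H}(\mathbb{D})$. If $T_g:H^\infty\to H^\infty$ is weakly compact, then $g\in A$.
   Context: $\mathbb{D}$ is the open unit disc, $\mathcal{H}(\mathbb{D})$ the space of analytic functions in $\mathbb{D}$, $H^\infty$ the bounded analytic functions in $\mathbb{D}$ with the sup norm, $A$ the disc algebra (functions analytic in $\mathbb{D}$ and continuous on $\overline{\mathbb{D}}$). $T_g(f)(z)=\int_0^z f(\zeta)g'(\zeta)\,d\zeta$. *)

(* Defs.v *)
From HB Require Import structures.
From mathcomp Require Import all_boot all_order all_algebra.
From mathcomp Require Import all_classical all_reals all_analysis.
From mathcomp Require Import complex.

Set Implicit Arguments.
Unset Strict Implicit.
Unset Printing Implicit Defensive.

Import Order.TTheory GRing.Theory Num.Theory numFieldNormedType.Exports.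
Import Normc.

Local Open Scope classical_set_scope.
Local Open Scope ring_scope.
Local Open Scope complex_scope.

(* The norm topology on R[i]; the library only provides it on R[i]^o. *)
HB.instance Definition _ (R : realType) := NormedModule.copy R[i] R[i]^o.

Section WeakTopology.
Variable K : numFieldType.

Definition dual (V : normedModType K) :=
  {l : V -> K | scalar l /\ continuous l}.

(* Coarsest topology making every bounded linear functional continuous. *)
Definition weak (V : normedModType K) : topologicalType :=
  sup_topology (fun l : dual V => Topological.on (initial_topology (sval l))).

Definition relatively_weakly_compact (V : normedModType K) (B : set V) :=
  precompact (B : set (weak V)).

Definition weakly_compact (V W : normedModType K) (T : V -> W) :=
  forall B : set V, bounded_set B -> relatively_weakly_compact (T @` B).

End WeakTopology.

Section Disc.
Variable R : realType.
Local Notation C := R[i].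

Definition disc : set C := [set z | `|z| < 1].

Definition analytic_at (f : C -> C) (a : C) :=
  exists (c : nat -> C) (r : R), 0 < r /\
    forall z, `|z - a| < r%:C ->
      series (fun n => c n * (z - a) ^+ n) @ \oo --> f z.

Definition analytic_on (D : set C) (f : C -> C) :=
  forall a, D a -> analytic_at f a.

Definition disc_algebra (g : C -> C) :=
  analytic_on disc g /\
  exists G : C -> C, {within closure disc, continuous G} /\
    forall z, disc z -> G z = g z.

Definition cintegral01 (h : R -> C) : C :=
  (\int[lebesgue_measure]_(t in `[0, 1]) complex.Re (h t))%R +i*
  (\int[lebesgue_measure]_(t in `[0, 1]) complex.Im (h t))%R.

(* T_g f (z), the integral being taken along the segment t |-> t z;
   derive1 over R[i] is the complex derivative. *)
Definition Volterra (g f : C -> C) (z : C) : C :=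
  cintegral01 (fun t => f (t%:C * z) * derive1 g (t%:C * z) * z).

(* Functions are total on R[i]; setting them to 0 outside the disc makes
   equality in Hinf the same as equality on the disc. *)
Definition is_Hinf (f : C -> C) : Prop :=
  [/\ analytic_on disc f,
      exists M : R, forall z, disc z -> normc (f z) <= M
    & forall z, ~ disc z -> f z = 0].

Definition Hinf_pred : {pred C -> C} := fun f => `[< is_Hinf f >].

Lemma HinfP f : reflect (is_Hinf f) (f \in Hinf_pred).
Proof. exact: asboolP. Qed.

Lemma normcE (z : C) : `|z| = (normc z)%:C.
Proof. by []. Qed.

Lemma normc_ge0 (z : C) : 0 <= normc z.
Proof. by case: z => a b; rewrite sqrtr_ge0. Qed.

Lemma normcD (x y : C) : normc (x + y) <= normc x + normc y.
Proof. by have := ler_normD x y; rewrite !normcE -rmorphD lecR. Qed.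

Lemma analytic_atD f g a :
  analytic_at f a -> analytic_at g a -> analytic_at (f + g) a.
Proof.
move=> [c [r [r0 cf]]] [d [s [s0 dg]]].
exists (fun n => c n + d n), (Num.min r s); split; first by rewrite lt_min r0.
move=> z; rewrite normcE ltcR lt_min => /andP[zr zs].
have -> : series (fun n => (c n + d n) * (z - a) ^+ n) =
    series (fun n => c n * (z - a) ^+ n) + series (fun n => d n * (z - a) ^+ n).
  by apply/funext => n; rewrite /series /= !fctE -big_split /=;
     apply: eq_bigr => i _; rewrite mulrDl.
by apply: cvgD; [apply: cf | apply: dg]; rewrite normcE ltcR.
Qed.

Lemma analytic_atZ (k : C) f a :
  analytic_at f a -> analytic_at (fun z => k * f z) a.
Proof.
move=> [c [r [r0 cf]]]; exists (fun n => k * c n), r; split; first exact: r0.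
move=> z zr.
have -> : series (fun n => k * c n * (z - a) ^+ n) =
    (fun=> k) * series (fun n => c n * (z - a) ^+ n).
  apply/funext => n; rewrite /series /= fctE mulr_sumr.
  by apply: eq_bigr => i _; rewrite mulrA.
apply: cvgM; [exact: cvg_cst|exact: cf].
Qed.

Lemma analytic_at0 a : analytic_at 0 a.
Proof.
exists (fun=> 0), 1; split; first exact: ltr01.
move=> z _.
have -> : series (fun n => 0 * (z - a) ^+ n) = fun=> 0.
  by apply/funext => n; rewrite /series /= big1// => i _; rewrite mul0r.
exact: cvg_cst.
Qed.

Lemma Hinf_submod : submod_closed Hinf_pred.
Proof.
split.
  apply/HinfP; split=> [a _||//]; first exact: analytic_at0.
  by exists 0 => z _; rewrite normc0.
move=> k f g /HinfP[af [M fM] f0] /HinfP[ag [N gN] g0]; apply/HinfP; split.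
- move=> a Da; apply: (@analytic_atD (fun z => k * f z)); last exact: ag.
  by apply: analytic_atZ; exact: af.
- exists (normc k * M + N) => z Dz.
  apply: (le_trans (normcD (k * f z) (g z))).
  apply: lerD; last exact: gN.
  by rewrite normcM ler_wpM2l ?normc_ge0 ?fM.
- move=> z nDz; rewrite -[LHS]/(k * f z + g z) f0// g0//.
  by rewrite mulr0 addr0.
Qed.

HB.instance Definition _ := GRing.isSubmodClosed.Build C (C -> C) Hinf_pred
  Hinf_submod.

Record Hinf := MkHinf { Hinf_fun :> C -> C; _ : Hinf_fun \in Hinf_pred }.

HB.instance Definition _ := [isSub for Hinf_fun].
HB.instance Definition _ := [Choice of Hinf by <:].
HB.instance Definition _ := [SubChoice_isSubLmodule of Hinf by <:].

Definition Hinf_norm (f : Hinf) : C := (sup [set normc (f z) | z in disc])%:C.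

Lemma disc0 : disc 0.
Proof. by rewrite /disc /= normr0 ltr01. Qed.

Lemma Hinf_has_sup (f : Hinf) : has_sup [set normc (f z) | z in disc].
Proof.
have [_ [M fM] _] := HinfP _ (valP f).
split; first by exists (normc (f 0)), 0 => //; exact: disc0.
by exists M => _ [z Dz <-]; exact: fM.
Qed.

Lemma Hinf_le_sup (f : Hinf) z : disc z ->
  normc (f z) <= sup [set normc (f z) | z in disc].
Proof.
by move=> Dz; apply: ub_le_sup; [exact: (Hinf_has_sup f).2|exists z].
Qed.

Lemma Hinf_sup_le (f : Hinf) M : (forall z, disc z -> normc (f z) <= M) ->
  sup [set normc (f z) | z in disc] <= M.
Proof.
move=> fM; apply: ge_sup; first exact: (Hinf_has_sup f).1.
by move=> _ [z Dz <-]; exact: fM.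
Qed.

Lemma Hinf_normD (f g : Hinf) :
  Hinf_norm (f + g) <= Hinf_norm f + Hinf_norm g.
Proof.
rewrite /Hinf_norm -rmorphD lecR; apply: Hinf_sup_le => z Dz.
apply: (le_trans (normcD (f z) (g z))).
by apply: lerD; exact: Hinf_le_sup.
Qed.

Lemma Hinf_normZ_le k (f : Hinf) : Hinf_norm (k *: f) <= `|k| * Hinf_norm f.
Proof.
rewrite /Hinf_norm normcE -rmorphM lecR; apply: Hinf_sup_le => z Dz.
rewrite -[X in normc X]/(k * f z) normcM ler_wpM2l ?normc_ge0//.
exact: Hinf_le_sup.
Qed.

Lemma Hinf_norm0 (f : Hinf) : Hinf_norm f = 0 -> f = 0.
Proof.
move=> f0; apply/val_inj/funext => z /=; rewrite -[RHS]/(0 : C).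
have [Dz|nDz] := pselect (disc z); last first.
  by have [_ _ fz0] := HinfP _ (valP f); exact: fz0.
apply: eq0_normc; apply/eqP; rewrite eq_le normc_ge0 andbT.
by apply: le_trans (Hinf_le_sup f Dz) _; rewrite -lecR [X in X <= _]f0.
Qed.

Lemma Hinf_normZ k (f : Hinf) : Hinf_norm (k *: f) = `|k| * Hinf_norm f.
Proof.
apply/eqP; rewrite eq_le Hinf_normZ_le /=.
have [->|k0] := eqVneq k 0.
  rewrite normr0 mul0r /Hinf_norm lecR.
  apply: le_trans (Hinf_le_sup _ disc0); exact: normc_ge0.
have := Hinf_normZ_le k^-1 (k *: f).
rewrite scalerA mulVf// scale1r normfV => H.
by rewrite -ler_pdivlMl// normr_gt0.
Qed.

HB.instance Definition _ := Lmodule_isNormed.Build C Hinf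
  Hinf_normD Hinf_normZ Hinf_norm0.

End Disc.
Arguments disc {R}.

(* Main.v *)
Require Import Defs.
From HB Require Import structures.
From mathcomp Require Import all_boot all_order all_algebra.
From mathcomp Require Import all_classical all_reals all_analysis.
From mathcomp Require Import complex.
From mathcomp Require Import ring lra.

(* Since [T] maps the constant 1 to [g - g 0], the symbol [g] is bounded. Fix
   [zeta] on the unit circle and let [f_n = 1 - ((1 + z / zeta) / 2) ^ n]: these
   polynomials are bounded by 2 on the disc, tend to 1 there and vanish at
   [zeta]. Integration by parts shows that [T f_n - f_n g] is a primitive of
   [- f_n' g], hence Lipschitz, so that [T f_n] has a limit at [zeta]. Having a
   limit at [zeta] is weakly closed: along two sequences tending to [zeta], the
   difference of the values has an ultrafilter limit, which is a bounded
   functional vanishing on every [T f_n]. A weak cluster point of [(T f_n)] is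
   [g] up to a constant near [zeta], so [g] also has a limit at [zeta]; the
   limits at all boundary points give the continuous extension. *)

Set Implicit Arguments.
Unset Strict Implicit.
Unset Printing Implicit Defensive.

Import Order.TTheory GRing.Theory Num.Theory numFieldNormedType.Exports.
Import Normc.

Local Open Scope classical_set_scope.
Local Open Scope ring_scope.
Local Open Scope complex_scope.

(** * The modulus on R[i] *)

Section Complex.
Context {R : realType}.
Local Notation C := R[i].
Local Notation Re := (@complex.Re R).
Local Notation Im := (@complex.Im R).
Implicit Types (z w : C).

Lemma complex_gt0 (e : C) : 0 < e -> exists2 d : R, 0 < d & e = d%:C.
Proof.
case: e => a b; rewrite ltcE /= => /andP[/eqP b0 a0].
by exists a => //; rewrite b0.
Qed.

Lemma normcN z : normc (- z) = normc z.
Proof. by case: z => a b /=; rewrite !sqrrN. Qed.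

Lemma normcB z w : normc (z - w) = normc (w - z).
Proof. by rewrite -normcN opprB. Qed.

Lemma normcX z n : normc (z ^+ n) = normc z ^+ n.
Proof. by elim: n => [|n IH]; rewrite ?normc1 // !exprS normcM IH. Qed.

Lemma normcR (x : R) : normc x%:C = `|x|.
Proof. by rewrite /= expr0n addr0 sqrtr_sqr. Qed.

Lemma normcn n : normc (n%:R : C) = n%:R.
Proof. by rewrite -(rmorph_nat (real_complex R)) normcR normr_nat. Qed.

Lemma normc_Re z : `|Re z| <= normc z.
Proof. by case: z => a b /=; rewrite -sqrtr_sqr ler_wsqrtr// lerDl sqr_ge0. Qed.

Lemma normc_Im z : `|Im z| <= normc z.
Proof. by case: z => a b /=; rewrite -sqrtr_sqr ler_wsqrtr// lerDr sqr_ge0. Qed.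

Lemma normc_le_ReIm z : normc z <= `|Re z| + `|Im z|.
Proof.
case: z => a b /=; rewrite -[leRHS]ger0_norm ?addr_ge0// -sqrtr_sqr.
rewrite ler_wsqrtr// sqrrD !real_normK ?num_real// addrAC lerDl.
by rewrite mulrn_wge0// mulr_ge0.
Qed.

Lemma normc_sum (I : Type) (r : seq I) (P : pred I) (F : I -> C) :
  normc (\sum_(i <- r | P i) F i) <= \sum_(i <- r | P i) normc (F i).
Proof.
elim/big_rec2: _ => [|i x y _ h]; first by rewrite normc0.
by apply: le_trans (normcD _ _) _; rewrite lerD2l.
Qed.

(** The norm of [C] takes values in [C], where a positive element is a positive real; real
    tolerances therefore suffice to test convergence. *)
Lemma cvgcP (T : Type) (F : set_system T) (f : T -> C) (l : C) : Filter F ->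
  (f @ F --> l) <-> (forall e : R, 0 < e -> \forall x \near F, normc (f x - l) < e).
Proof.
move=> FF; split=> [/cvgrPdistC_lt fl e e0|fl].
  have /fl : 0 < e%:C by rewrite ltcE /= eqxx.
  by apply: filterS => x; rewrite Defs.normcE ltcR.
apply/cvgrPdistC_lt => e /complex_gt0[d d0 ->]; have := fl _ d0.
by apply: filterS => x; rewrite Defs.normcE ltcR.
Qed.

Lemma nbhscP (a : C) (P : set C) :
  nbhs a P <-> exists2 r : R, 0 < r & forall z, normc (z - a) < r -> P z.
Proof.
rewrite -nbhs_ballE; split=> [[e /= /complex_gt0[d d0 ->] eP]|[r r0 rP]].
  by exists d => // z zd; apply: eP; rewrite /ball /= distrC Defs.normcE ltcR.
exists r%:C => /=; first by rewrite ltcE /= eqxx.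
by move=> z; rewrite /ball /= distrC Defs.normcE ltcR; exact: rP.
Qed.

End Complex.

(** * Limits of bounded complex families along an ultrafilter *)

Section Ultra.
Context {R : realType} {I : Type} (U : set_system I) (UU : UltraFilter U).
Local Notation C := R[i].
Local Notation Re := (@complex.Re R).
Local Notation Im := (@complex.Im R).

Let PU : ProperFilter U := @ultra_proper _ _ UU.

(** Compactness of [[-M, M]] yields a cluster point. Along an ultrafilter it is a limit, since [U]
    contains the preimage of a neighbourhood or its complement. *)
Lemma ultra_bounded_cvgR (u : I -> R) (M : R) :
  (forall i, `|u i| <= M) -> exists l : R, u @ U --> l.
Proof.
move=> uM; have uU : (u @ U) `[- M, M]%classic.
  by apply: (@filterE _ U) => i /=; rewrite in_itv /= -ler_norml.
have [l [_ ul]] := @segment_compact R (- M) M (u @ U) _ uU.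
exists l => V Vl; have [//|UV] := in_ultra_setVsetC (u @^-1` V) UU.
by have [x [/= + Vx]] := ul (~` V) V UV Vl.
Qed.

(** One fixed [U] serves every bounded family at once, so the limit depends linearly on the family;
    an extracted subsequence would depend on the family. *)
Lemma ultra_bounded_cvg (u : I -> C) (M : R) :
  (forall i, normc (u i) <= M) -> exists l : C, u @ U --> l.
Proof.
move=> uM.
have [a ua] := @ultra_bounded_cvgR (Re \o u) M
  (fun i => le_trans (normc_Re _) (uM i)).
have [b ub] := @ultra_bounded_cvgR (Im \o u) M
  (fun i => le_trans (normc_Im _) (uM i)).
exists (a +i* b); apply/cvgcP => e e0.
have e20 : 0 < e / 2 by rewrite divr_gt0.
move/cvgrPdistC_lt : ua => /(_ _ e20) ua; move/cvgrPdistC_lt : ub => /(_ _ e20) ub.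
apply: filterS2 ua ub => i /= ha hb; apply: le_lt_trans (normc_le_ReIm _) _.
rewrite (splitr e) ltrD//.
  by move: ha; case: (u i).
by move: hb; case: (u i).
Qed.

Lemma cvg_normc_le (u : I -> C) l (M : R) :
  u @ U --> l -> (\forall i \near U, normc (u i) <= M) -> normc l <= M.
Proof.
move=> /cvgcP ul uM; apply/ler_addgt0Pr => e /ul ule.
have [i [h1 h2]] := filter_ex (filterI ule uM).
rewrite (_ : l = u i - (u i - l)); last by ring.
apply: le_trans (normcD _ _) _; rewrite normcN lerD//; exact: ltW.
Qed.

End Ultra.

(** * Derivatives of power series *)

Section PowerSeries.
Context {R : realType}.
Local Notation C := R[i].

(** Induction on [n]: the remainder of order [n + 1] is [z] times the previous one plus
    [n w^(n-1) (z - w)^2]. The power of 2 absorbs the factor [n], and the factor [p ^+ 2] avoids the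
    exponent [n - 2]. *)
Lemma normc_expr_taylor (z w : C) (p : R) n : normc z <= p -> normc w <= p ->
  p ^+ 2 * normc (z ^+ n - w ^+ n - n%:R * w ^+ n.-1 * (z - w))
    <= (2 * p) ^+ n * normc (z - w) ^+ 2.
Proof.
move=> zp wp; have p0 : 0 <= p := le_trans (normc_ge0 z) zp.
elim: n => [|n IH].
  rewrite !expr0 mul0r mul0r subrr subr0 normc0 mulr0 mulr_ge0//.
  by rewrite exprn_ge0 ?normc_ge0.
have -> : z ^+ n.+1 - w ^+ n.+1 - n.+1%:R * w ^+ n.+1.-1 * (z - w) =
    z * (z ^+ n - w ^+ n - n%:R * w ^+ n.-1 * (z - w))
    + n%:R * w ^+ n.-1 * (z - w) ^+ 2.
  case: n {IH} => [|n] /=; first by rewrite !expr0 !expr1; ring.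
  by rewrite !exprS -(natr1 n.+1) -(natr1 n); ring.
have hn : p ^+ 2 * (n%:R * normc w ^+ n.-1) <= 2 ^+ n * p ^+ n.+1.
  apply: (@le_trans _ _ (n%:R * p ^+ n.+1)).
    case: n {IH} => [|n]; first by rewrite !mul0r mulr0.
    rewrite mulrCA ler_wpM2l ?ler0n//= [leRHS](exprD p 2 n) ler_wpM2l ?exprn_ge0//.
    by rewrite lerXn2r ?nnegrE ?normc_ge0.
  rewrite ler_wpM2r ?exprn_ge0// -natrX ler_nat; exact/ltnW/ltn_expl.
apply: (@le_trans _ _ (p ^+ 2 * (normc z * normc (z ^+ n - w ^+ n - n%:R * w ^+ n.-1 * (z - w))
   + n%:R * normc w ^+ n.-1 * normc (z - w) ^+ 2))).
  rewrite ler_wpM2l ?exprn_ge0//; apply: le_trans (normcD _ _) _.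
  by rewrite !normcM !normcX normcn.
rewrite mulrDr mulrCA.
(* Both summands equal [2^n p^(n+1) |z - w|^2], so together they give the required power of
   [2 * p]. *)
apply: (@le_trans _ _ (p * ((2 * p) ^+ n * normc (z - w) ^+ 2) +
   2 ^+ n * p ^+ n.+1 * normc (z - w) ^+ 2)).
  apply: lerD.
    apply: ler_pM => //; first exact: normc_ge0.
    by rewrite mulr_ge0 ?normc_ge0 ?exprn_ge0.
  by rewrite mulrA ler_wpM2r// exprn_ge0 ?normc_ge0.
by rewrite le_eqVlt; apply/orP; left; apply/eqP; rewrite !exprMn !exprS; ring.
Qed.

End PowerSeries.

(** * Second-order Taylor bounds for analytic functions *)

Section Analytic.
Context {R : realType}.
Local Notation C := R[i].

(* A symmetric second-order Taylor bound: besides differentiability at every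
   point near [a], exchanging [z] and [w] gives the continuity of [f']. *)
Definition taylor2_at (f f' : C -> C) (a : C) :=
  exists p K : R, 0 < p /\ forall z w, normc (z - a) < p -> normc (w - a) < p ->
    normc (f z - f w - f' w * (z - w)) <= K * normc (z - w) ^+ 2.

Lemma sum_half_le (n : nat) : \sum_(0 <= k < n) (2^-1 : R) ^+ k <= 2.
Proof.
have e : \sum_(0 <= k < n) (2^-1 : R) ^+ k + 2 * 2^-1 ^+ n = 2.
  elim: n => [|n IH]; first by rewrite big_nil expr0 add0r mulr1.
  by rewrite big_nat_recr//= -[RHS]IH exprS; field.
by rewrite -[leRHS]e lerDl mulr_ge0// exprn_ge0// invr_ge0.
Qed.

Lemma cvg_series_terms_bounded (u : nat -> C) (l : C) :
  series u @ \oo --> l -> exists M : R, forall n, normc (u n) <= M.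
Proof.
move=> ul; have /cvg_seq_bounded : cvgn (series u) by apply/cvg_ex; exists l.
case/pinfty_ex_gt0 => _ /complex_gt0[M M0 ->] uM.
have {}uM n : normc (series u n) <= M.
  by have := uM n I; rewrite /= Defs.normcE lecR.
exists (M + M) => n.
rewrite (_ : u n = series u n.+1 - series u n); last first.
  by rewrite /series /= big_nat_recr//= addrAC subrr add0r.
by apply: le_trans (normcD _ _) _; rewrite normcN lerD.
Qed.

(** Bounded terms at distance [4 * p] from [a] make the sums of [|c_k| (2p)^k] bounded, so the
    bounds of [normc_expr_taylor] add up. The derivative is defined as the limit along an
    ultrafilter of the termwise derived partial sums, which only have to be bounded. *)
Lemma analytic_at_taylor2 (f : C -> C) a :
  analytic_at f a -> exists f', taylor2_at f f' a.
Proof.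
move=> [c [r [r0 cf]]].
have [U [UU Uoo]] := @ultraFilterLemma nat \oo _.
(* The point [a + 4 * p] is at distance [r / 2], inside the disc of convergence. Passing from
   [4 * p] to [2 * p] gains the geometric factor [2^-n]. *)
pose p := r / 8; have p0 : 0 < p by rewrite divr_gt0.
have [|M cM] := @cvg_series_terms_bounded (fun n => c n * (4 * p)%:C ^+ n)
    (f (a + (4 * p)%:C)).
  have /cf : `|a + (4 * p)%:C - a| < r%:C.
    rewrite addrAC subrr add0r Defs.normcE ltcR normcR ger0_norm ?mulr_ge0// ?ltW//.
    by rewrite /p; lra.
  by rewrite addrAC subrr add0r.
have {}cM n : normc (c n) * (2 * p) ^+ n <= M * 2^-1 ^+ n.
  have := cM n; rewrite normcM normcX normcR ger0_norm; last by rewrite mulr_ge0// ltW.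
  move=> h; rewrite (_ : 2 * p = 4 * p * 2^-1); last by field.
  by rewrite exprMn mulrA ler_wpM2r// exprn_ge0// invr_ge0.
have csum n : \sum_(0 <= k < n) normc (c k) * (2 * p) ^+ k <= M * 2.
  apply: (@le_trans _ _ (\sum_(0 <= k < n) M * 2^-1 ^+ k)); first exact: ler_sum.
  rewrite -mulr_sumr ler_wpM2l ?sum_half_le//.
  by have := cM 0%N; rewrite !expr0 !mulr1; apply: le_trans; exact: normc_ge0.
pose D w n : C := \sum_(0 <= k < n) c k * (k%:R * (w - a) ^+ k.-1).
have DU w : normc (w - a) < p -> exists l : C, D w @ U --> l.
  move=> wp; apply: (@ultra_bounded_cvg _ _ _ _ _ (M * 2 / p)) => n.
  rewrite ler_pdivlMr//; apply: le_trans (csum n).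
  apply: (@le_trans _ _ (\sum_(0 <= k < n) normc (c k * (k%:R * (w - a) ^+ k.-1)) * p)).
    by rewrite -mulr_suml ler_wpM2r ?(ltW p0)// normc_sum.
  apply: ler_sum => k _; rewrite normcM -mulrA ler_wpM2l ?normc_ge0//.
  rewrite normcM normcX normcn; case: k => [|k]; first by rewrite !mul0r.
  rewrite exprMn -mulrA /= ler_pM ?ler0n ?mulr_ge0 ?exprn_ge0 ?normc_ge0 ?(ltW p0) ?(ltW r0)//.
    by rewrite -natrX ler_nat; exact/ltnW/ltn_expl.
  by rewrite exprSr ler_wpM2r ?(ltW p0)// lerXn2r ?nnegrE ?normc_ge0 ?(ltW p0) ?(ltW wp).
have {}DU w : exists l : C, normc (w - a) < p -> D w @ U --> l.
  have [/DU[l Dl]|] := boolP (normc (w - a) < p); first by exists l.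
  by exists 0.
have [f' Df'] := choice DU.
exists f', p, (M * 2 / p ^+ 2); split=> // z w zp wp.
have S w1 : normc (w1 - a) < p ->
    series (fun n => c n * (w1 - a) ^+ n) @ U --> f w1.
  move=> w1p; have /cf : `|w1 - a| < r%:C.
    by rewrite Defs.normcE ltcR (lt_trans w1p)// /p; lra.
  exact: cvg_trans (cvg_app _ Uoo).
(* All limits are along [U], so the partial sums combine first: [E n] is a finite combination of the
   remainders of [normc_expr_taylor], with a bound independent of [n]. *)
pose E := ((series (fun n => c n * (z - a) ^+ n)
  - series (fun n => c n * (w - a) ^+ n)) - D w * cst (z - w)) : nat -> C.
have EU : E @ U --> f z - f w - f' w * (z - w).
  apply: cvgB; first by apply: cvgB; exact: S.
  by apply: cvgM; [exact: Df'|exact: cvg_cst].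
apply: (@cvg_normc_le _ _ U UU E _ _ EU); apply: filterE => n.
rewrite mulrAC ler_pdivlMr ?exprn_gt0//.
have -> : E n = \sum_(0 <= k < n) c k * ((z - a) ^+ k - (w - a) ^+ k -
     k%:R * (w - a) ^+ k.-1 * ((z - a) - (w - a))).
  rewrite (_ : z - a - (w - a) = z - w); last by ring.
  rewrite /E /D /series !fctE /= mulr_suml -!sumrB.
  by apply: eq_bigr => k _; ring.
apply: (@le_trans _ _ (\sum_(0 <= k < n) normc (c k) * (2 * p) ^+ k * normc (z - w) ^+ 2)).
  apply: (@le_trans _ _ (\sum_(0 <= k < n) normc (c k * ((z - a) ^+ k - (w - a) ^+ k -
     k%:R * (w - a) ^+ k.-1 * ((z - a) - (w - a)))) * p ^+ 2)).
    by rewrite -mulr_suml ler_wpM2r ?exprn_ge0 ?(ltW p0)// normc_sum.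
  apply: ler_sum => k _; rewrite normcM -!mulrA ler_wpM2l ?normc_ge0// [leLHS]mulrC !mulrA.
  have := normc_expr_taylor k (ltW zp) (ltW wp).
  rewrite (_ : z - a - (w - a) = z - w); last by ring.
  by rewrite !mulrA.
by rewrite -mulr_suml ler_wpM2r// exprn_ge0 ?normc_ge0.
Qed.

End Analytic.

(** * Complex derivatives and integrals along segments *)

Section Derive.
Context {K : numFieldType} {V W : normedModType K}.

(** Multiplying the difference quotient by [h] gives a bound that also holds at [h = 0], which
    trades the punctured neighbourhood for a full one. *)
Lemma is_derive_littleoP (f : V -> W) (x v : V) (d : W) :
  is_derive x v f d <->
  forall e : K, 0 < e ->
    \forall h \near 0, `|f (h *: v + x) - f x - h *: d| <= e * `|h|.
Proof.
have q (h : K) : h != 0 -> `|f (h *: v + x) - f x - h *: d| =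
    `|d - h^-1 *: (f (h *: v + x) - f x)| * `|h|.
  move=> h0; rewrite [LHS]distrC mulrC -normrZ scalerBr scalerA divff//.
  by rewrite scale1r.
split=> [[df dE] e e0|H].
  have /cvgrPdist_le/(_ _ e0) : h^-1 *: (f (h *: v + x) - f x) @[h --> 0^'] --> d
    by rewrite -dE; exact: df.
  rewrite near_withinE; apply: filterS => h H; have [->|h0] := eqVneq h 0.
    by rewrite scale0r add0r subrr scale0r subr0 !normr0 mulr0.
  by rewrite q// ler_wpM2r// H.
have cf : h^-1 *: (f (h *: v + x) - f x) @[h --> 0^'] --> d.
  apply/cvgrPdist_le => e e0; rewrite near_withinE; move: (H _ e0).
  apply: filterS => h + h0; rewrite q// ler_pM2r//.
  by rewrite normr_gt0.
by apply: DeriveDef; [apply/cvg_ex; exists d|exact: cvg_lim].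
Qed.

End Derive.

(** * The fundamental theorem of calculus over the unit interval *)

Section RealIntegral.
Context {R : realType}.
Local Notation mu := (@lebesgue_measure R).

Lemma Rintegral01_derive (F f : R -> R) :
  (forall t : R, 0 <= t <= 1 -> is_derive t 1 F (f t)) ->
  (forall t : R, 0 <= t <= 1 -> {for t, continuous f}) ->
  (\int[mu]_(t in `[0, 1]) f t)%R = F 1 - F 0.
Proof.
move=> dF cf.
have cF (t : R) : 0 <= t <= 1 -> {for t, continuous F}.
  move=> /dF[+ _] => /derivable1_diffP; exact: differentiable_continuous.
rewrite /Rintegral (@continuous_FTC2 _ f F 0 1)//.
- apply/continuous_in_subspaceT => x; rewrite inE /= in_itv; exact: cf.
- split.
  + by move=> x; rewrite in_itv /= => /andP[x0 x1]; have [|//] := dF x; rewrite !ltW.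
  + by apply: cvg_at_right_filter; apply: cF; rewrite lexx ler01.
  + by apply: cvg_at_left_filter; apply: cF; rewrite lexx ler01.
- move=> x; rewrite in_itv /= => /andP[x0 x1].
  by rewrite derive1E; apply: derive_val; apply: dF; rewrite !ltW.
Qed.

(** The substitution [s = t * r] turns the integral into [F r - F 0] for a primitive [F] of [f].
    This computes the derivative of a Volterra integral along a ray. *)
Lemma is_derive_scaled_integral (f : R -> R) (d : R) : 0 < d ->
  (forall t : R, - d < t < 1 + d -> {for t, continuous f}) ->
  is_derive (1 : R) (1 : R) (fun r : R => (\int[mu]_(t in `[0, 1]) (f (t * r) * r))%R)
    (f 1).
Proof.
(* Widening by [d / 2] makes 0 and 1 interior points of [[a, b]], so [F] is differentiable there,
   while [f] remains continuous on all of [[a, b]]. *)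
move=> d0 cf; pose a := - (d / 2); pose b := 1 + d / 2.
pose F (x : R) := (\int[mu]_(t in `[a, x]) f t)%R.
have fi : mu.-integrable `[a, b] (EFin \o f).
  apply: continuous_compact_integrable; first exact: segment_compact.
  apply/continuous_in_subspaceT => x; rewrite inE /= in_itv /= => /andP[ax xb].
  by apply: cf; move: ax xb; rewrite /a /b; lra.
have dF (x : R) : a < x < b -> is_derive x 1 F (f x).
  move=> /andP[ax xb].
  have [|dF1 dF2] := @continuous_FTC1_closed _ f a x b xb fi ax.
    by apply: cf; move: ax xb; rewrite /a /b; lra.
  by apply: DeriveDef; [exact: dF1|rewrite -derive1E dF2].
have E (r : R) : 0 < r < b -> (\int[mu]_(t in `[0, 1]) (f (t * r) * r))%R = F r - F 0.
  move=> /andP[r0 rb].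
  have tr (t : R) : 0 <= t <= 1 -> 0 <= t * r <= r.
    move=> /andP[t0 t1]; rewrite mulr_ge0 ?(ltW r0)//=.
    by rewrite -[leRHS]mul1r ler_wpM2r// ltW.
  have -> : F r - F 0 = F (1 * r) - F (0 * r) by rewrite mul1r mul0r.
  apply: (@Rintegral01_derive (fun t => F (t * r)) (fun t => f (t * r) * r)).
    move=> t /tr/andP[h1 h2].
    have dm : is_derive t 1 (fun t : R => t * r) r.
      by apply: is_derive_eq; rewrite scaler0 add0r /GRing.scale /= mulr1.
    apply: (@is_derive1_comp _ F (fun t : R => t * r)); apply: dF.
    by move: r0 rb h1 h2; rewrite /a /b; lra.
  move=> t /tr/andP[h1 h2]; apply: cvgM; last exact: cvg_cst.
  apply: (@continuous_comp _ _ _ (fun t : R => t * r) f).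
    by apply: cvgM; [exact: cvg_id|exact: cvg_cst].
  by apply: cf; move: r0 rb h1 h2; rewrite /b; lra.
have dF1 : is_derive (1 : R) (1 : R) (fun r => F r - F 0) (f 1).
  have d1 : is_derive (1 : R) (1 : R) F (f 1) by apply: dF; rewrite /a /b; lra.
  by apply: is_derive_eq; rewrite subr0.
apply: near_eq_is_derive dF1.
have h : (0 < 1 :> R) /\ (1 < b) by rewrite /b; split; lra.
near=> r; apply/esym/E/andP; split; near: r.
  exact: lt_nbhsr h.1.
exact: lt_nbhsl h.2.
Unshelve. all: by end_near. Qed.

End RealIntegral.

Section ComplexDerivative.
Context {R : realType}.
Local Notation C := R[i].
Local Notation Re := (@complex.Re R).
Local Notation Im := (@complex.Im R).

Lemma taylor2_is_derive (f f' : C -> C) a : taylor2_at f f' a ->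
  exists2 p : R, 0 < p & forall w, normc (w - a) < p -> is_derive w 1 f (f' w).
Proof.
move=> [p [K [p0 pK]]]; exists p => // w wp.
apply/is_derive_littleoP => _ /complex_gt0[e e0 ->].
(* The first bound keeps [h + w] in the ball where the Taylor bound holds. The divisor is [|K| + 1]
   because [K] may be zero or negative. *)
pose d := Num.min (p - normc (w - a)) (e / (`|K| + 1)).
have K1 : 0 < `|K| + 1 by rewrite ltr_wpDl.
have d0 : 0 < d by rewrite lt_min subr_gt0 wp divr_gt0.
apply/nbhscP; exists d => // h; rewrite subr0 lt_min => /andP[hp he].
rewrite /GRing.scale /= mulr1 !Defs.normcE -rmorphM lecR.
have hwp : normc (h + w - a) < p.
  rewrite -addrA; apply: le_lt_trans (normcD _ _) _.
  by move: hp; rewrite ltrBrDr.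
have := pK _ _ hwp wp; rewrite addrK mulrC => /le_trans; apply.
rewrite expr2 mulrA ler_wpM2r ?normc_ge0//.
move: he; rewrite ltr_pdivlMr// => he; apply: le_trans (ltW he).
rewrite mulrC ler_wpM2l ?normc_ge0//.
by rewrite (le_trans (ler_norm K))// lerDl.
Qed.

Lemma analytic_at_derive (f : C -> C) a : analytic_at f a ->
  [/\ is_derive a 1 f ((derive1 f) a), {for a, continuous f} &
      {for a, continuous (derive1 f)}].
Proof.
move=> /analytic_at_taylor2[f' ff']; have [p p0 df] := taylor2_is_derive ff'.
have aa : normc (a - a) < p by rewrite subrr normc0.
have da := df _ aa.
have E w : normc (w - a) < p -> derive1 f w = f' w.
  by move=> /df dw; rewrite derive1E; exact: derive_val.
split; first by rewrite E.
  apply: differentiable_continuous; apply/derivable1_diffP.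
  by case: da.
have [q [K [q0 qK]]] := ff'.
apply: (@cvgcP R C (nbhs a) (derive1 f) (derive1 f a) _).2 => e e0.
apply/nbhscP.
have K1 : 0 < `|K| + 1 by rewrite ltr_wpDl.
exists (Num.min (Num.min p q) (e / 2 / (`|K| + 1))).
  by rewrite !lt_min p0 q0 !divr_gt0.
move=> z; rewrite !lt_min => /andP[/andP[zp zq] ze].
rewrite E// E//; have [->|za] := eqVneq z a; first by rewrite subrr normc0.
have aq : normc (a - a) < q by rewrite subrr normc0.
have h1 := qK _ _ zq aq; have h2 := qK _ _ aq zq.
have nz : 0 < normc (z - a).
  rewrite lt_neqAle normc_ge0 andbT eq_sym.
  by apply: contra_neq za => /eq0_normc/eqP; rewrite subr_eq0 => /eqP.
rewrite -(ltr_pM2r nz) -normcM.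
(* In the sum of the expansions at [a] and at [z] the values of [f] cancel; cancelling a factor
   [normc (z - a)] leaves a bound linear in it. *)
have -> : (f' z - f' a) * (z - a) = (f z - f a - f' a * (z - a))
   + (f a - f z - f' z * (a - z)) by ring.
apply: le_lt_trans (normcD _ _) _.
apply: (@le_lt_trans _ _ (2 * (`|K| + 1) * normc (z - a) ^+ 2)).
  rewrite -mulrA mulr_natl mulr2n; apply: lerD.
    apply: le_trans h1 _; rewrite ler_wpM2r ?exprn_ge0 ?normc_ge0//.
    by rewrite (le_trans (ler_norm K))// lerDl.
  apply: le_trans h2 _; rewrite normcB.
  by rewrite ler_wpM2r ?exprn_ge0 ?normc_ge0// (le_trans (ler_norm K))// lerDl.
rewrite expr2 mulrA ltr_pM2r//; move: ze; rewrite ltr_pdivlMr// ltr_pdivlMr//.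
apply: le_lt_trans; rewrite le_eqVlt; apply/orP; left; apply/eqP; ring.
Qed.

(** Restricting the complex increment to [h%:C * v] with [h] real reduces complex calculus to two
    real functions, to which the mean value theorem and the fundamental theorem apply. *)
Lemma is_derive_line (F : C -> C) (w v d : C) (t : R) :
  is_derive (w + t%:C * v) 1 F d ->
  is_derive t 1 (fun s : R => Re (F (w + s%:C * v))) (Re (d * v)) /\
  is_derive t 1 (fun s : R => Im (F (w + s%:C * v))) (Im (d * v)).
Proof.
move=> /is_derive_littleoP dF.
suff H e : 0 < e -> \forall h \near (0 : R),
    normc (F (w + (h + t)%:C * v) - F (w + t%:C * v) - h%:C * (d * v)) <= e * `|h|.
  split; apply/is_derive_littleoP => e /H; apply: filterS => h;
    rewrite /GRing.scale /= mulr1; apply: le_trans.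
    apply: le_trans (normc_Re _); rewrite le_eqVlt; apply/orP; left; apply/eqP.
    congr `| _ |; case: (F _) => ? ?; case: (F _) => ? ?; case: (d * v) => ? ? /=.
    by ring.
  apply: le_trans (normc_Im _); rewrite le_eqVlt; apply/orP; left; apply/eqP.
  congr `| _ |; case: (F _) => ? ?; case: (F _) => ? ?; case: (d * v) => ? ? /=.
  by ring.
move=> e0; have v1 : 0 < normc v + 1 by rewrite ltr_wpDl ?normc_ge0.
have := dF (e / (normc v + 1))%:C; rewrite ltcE /= eqxx divr_gt0// => /(_ isT).
move=> /nbhscP[r r0 rP].
have rv : 0 < r / (normc v + 1) by rewrite divr_gt0.
near=> h.
have := rP (h%:C * v); rewrite subr0 normcM normcR.
have hr : `|h| * normc v < r.
  apply: (@le_lt_trans _ _ (`|h| * (normc v + 1))).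
    by rewrite ler_wpM2l// lerDl.
  rewrite -ltr_pdivlMr//; near: h.
move=> /(_ hr); rewrite /GRing.scale /= mulr1 !Defs.normcE -rmorphM lecR.
rewrite normcM normcR.
rewrite (_ : (h + t)%:C * v = h%:C * v + t%:C * v); last by rewrite rmorphD mulrDl.
rewrite (addrCA w) (mulrC d) [h%:C * (v * d)]mulrA => /le_trans; apply.
rewrite -mulrA ler_wpM2l ?(ltW e0)// mulrCA -[leRHS]mulr1.
by rewrite ler_wpM2l// ler_pdivrMl// mulr1 lerDl.
Unshelve. all: by end_near. Qed.

(** The intermediate point may differ for the real and the imaginary part, so the real mean value
    theorem is applied to each; this costs the factor 2. *)
Lemma normc_mean_value (F F' : C -> C) (a b : C) (M : R) :
  (forall t : R, 0 <= t <= 1 ->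
     is_derive (a + t%:C * (b - a)) 1 F (F' (a + t%:C * (b - a))) /\
     normc (F' (a + t%:C * (b - a))) <= M) ->
  normc (F b - F a) <= 2 * (M * normc (b - a)).
Proof.
move=> dF.
have mv (P : C -> R) : (forall z, `|P z| <= normc z) -> {morph P : x y / x - y} ->
    (forall t : R, 0 <= t <= 1 -> is_derive t 1 (fun s : R => P (F (a + s%:C * (b - a))))
      (P (F' (a + t%:C * (b - a)) * (b - a)))) ->
    `|P (F b - F a)| <= M * normc (b - a).
  move=> Pn PB dP.
  have [x||t t01] := @MVT_segment R (fun s => P (F (a + s%:C * (b - a))))
     (fun t => P (F' (a + t%:C * (b - a)) * (b - a))) 0 1 ler01.
  - by rewrite in_itv /= => /andP[t0 t1]; apply: dP; rewrite !ltW.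
  - apply/continuous_in_subspaceT => x; rewrite inE /= in_itv /= => /dP[+ _].
    by move=> /derivable1_diffP; exact: differentiable_continuous.
  rewrite rmorph0 mul0r addr0 rmorph1 mul1r [a + _]addrC subrK subr0 mulr1 -PB => ->.
  apply: le_trans (Pn _) _; rewrite normcM ler_wpM2r ?normc_ge0//.
  by apply: (dF t _).2; move: t01; rewrite in_itv.
apply: le_trans (normc_le_ReIm _) _; rewrite mulr_natl mulr2n; apply: lerD.
  apply: mv; [exact: normc_Re|by case=> ? ? [? ?]|].
  by move=> t /dF[/is_derive_line[]].
apply: mv; [exact: normc_Im|by case=> ? ? [? ?]|].
by move=> t /dF[/is_derive_line[]].
Qed.

Lemma continuous_Re : continuous Re.
Proof.
move=> z; apply/(@cvgrPdistC_lt _ _ _ (nbhs z)) => e e0; apply/nbhscP; exists e => // w.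
by apply: le_lt_trans; apply: le_trans (normc_Re _); case: w; case: z.
Qed.

Lemma continuous_Im : continuous Im.
Proof.
move=> z; apply/(@cvgrPdistC_lt _ _ _ (nbhs z)) => e e0; apply/nbhscP; exists e => // w.
by apply: le_lt_trans; apply: le_trans (normc_Im _); case: w; case: z.
Qed.

Lemma continuous_scale_line (z : C) : continuous (fun t : R => t%:C * z).
Proof.
move=> t.
apply: (@cvgcP R R (nbhs t) (fun t : R => t%:C * z) (t%:C * z) _).2 => e e0.
have z1 : 0 < normc z + 1 by rewrite ltr_wpDl ?normc_ge0.
near=> s; rewrite -mulrBl -rmorphB normcM normcR.
apply: (@le_lt_trans _ _ (`|s - t| * (normc z + 1))).
  by rewrite ler_wpM2l// lerDl.
rewrite -ltr_pdivlMr//; near: s.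
by apply: (@cvgr_distC_lt _ _ _ (nbhs t) _ id t); [exact: cvg_id|rewrite divr_gt0].
Unshelve. all: by end_near. Qed.

Lemma continuous_ReIm_line (F : C -> C) (z : C) (t : R) :
  {for t%:C * z, continuous F} ->
  {for t, continuous (fun s : R => Re (F (s%:C * z) * z))} /\
  {for t, continuous (fun s : R => Im (F (s%:C * z) * z))}.
Proof.
move=> cF; have c : {for t, continuous (fun s : R => F (s%:C * z) * z)}.
  apply: cvgM; last exact: cvg_cst.
  apply: (@continuous_comp _ _ _ (fun s : R => s%:C * z) F); last exact: cF.
  exact: continuous_scale_line.
by split; apply: continuous_comp c _; [exact: continuous_Re|exact: continuous_Im].
Qed.

Lemma cintegral01_derive (F F' : C -> C) (z : C) :
  (forall t : R, 0 <= t <= 1 -> is_derive (t%:C * z) 1 F (F' (t%:C * z))) ->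
  (forall t : R, 0 <= t <= 1 -> {for t%:C * z, continuous F'}) ->
  cintegral01 (fun t => F' (t%:C * z) * z) = F z - F 0.
Proof.
move=> dF cF; rewrite /cintegral01.
have E1 : (0 + 1%:C * z : C) = z by rewrite rmorph1 mul1r add0r.
have E0 : (0 + 0%:C * z : C) = 0 by rewrite rmorph0 mul0r add0r.
have dl t : 0 <= t <= 1 -> is_derive (0 + t%:C * z) 1 F (F' (t%:C * z)).
  by rewrite add0r; exact: dF.
have dRe t t01 := (is_derive_line (dl t t01)).1.
have dIm t t01 := (is_derive_line (dl t t01)).2.
have IRe := Rintegral01_derive dRe (fun t t01 => (continuous_ReIm_line (cF t t01)).1).
have IIm := Rintegral01_derive dIm (fun t t01 => (continuous_ReIm_line (cF t t01)).2).
rewrite /= in IRe IIm; rewrite IRe IIm E1 E0.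
by case: (F z) => ? ?; case: (F 0).
Qed.

(** Since [V] is assumed differentiable at [z], differentiating along the ray through [z] is enough
    to find the derivative, without path independence. The ray gives [d * z = f z * z], whence
    [z != 0]. *)
Lemma cintegral01_scaled_derive (V f : C -> C) (z d : C) :
  z != 0 -> disc z ->
  (forall w, disc w -> V w = cintegral01 (fun t => f (t%:C * w) * w)) ->
  (forall w, disc w -> {for w, continuous f}) ->
  is_derive z 1 V d -> d = f z.
Proof.
move=> z0 Dz VE cf dV; apply: (mulIf z0).
have [k k0 kz] : exists2 k : R, 0 < k & forall t : R, - k < t < 1 + k -> disc (t%:C * z).
  have z1 : normc z < 1 by rewrite -ltcR -Defs.normcE.
  (* With [x = normc z] this gives [|t| < 2 - x], and [(2 - x) x < 1] because
     [1 - (2 - x) x = (1 - x)^2]. *)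
  exists (1 - normc z); first by rewrite subr_gt0.
  move=> t tk; rewrite /disc /= Defs.normcE normcM normcR ltcR.
  have tn : `|t| < 1 + (1 - normc z).
    by move: tk => /andP[? ?]; rewrite ltr_norml; apply/andP; split; lra.
  have n0 := normc_ge0 z; have t0 := normr_ge0 t; nra.
have cl t : - k < t < 1 + k -> {for t%:C * z, continuous f} by move=> /kz; exact: cf.
have dl : is_derive (0 + 1%:C * z) 1 V d by rewrite rmorph1 mul1r add0r.
have [dRe dIm] := is_derive_line dl.
have dRe' := is_derive_scaled_integral k0 (fun t tk => (continuous_ReIm_line (cl t tk)).1).
have dIm' := is_derive_scaled_integral k0 (fun t tk => (continuous_ReIm_line (cl t tk)).2).
have V1 : \forall s \near (1 : R), disc (s%:C * z).
  near=> s; apply: kz; apply/andP; split; near: s.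
    by apply: lt_nbhsr; lra.
  by apply: lt_nbhsl; lra.
have scaleE (s t : R) : t%:C * (s%:C * z) = (t * s)%:C * z.
  by rewrite rmorphM mulrA.
have eRe : \forall s \near (1 : R), Re (V (0 + s%:C * z)) =
    (\int[lebesgue_measure]_(t in `[0, 1]) (Re (f ((t * s)%:C * z) * z) * s))%R.
  apply: filterS V1 => s /VE; rewrite add0r => -> /=.
  apply: eq_Rintegral => t _; rewrite scaleE mulrCA.
  by case: (f _ * z) => ? ? /=; rewrite mul0r subr0 mulrC.
have eIm : \forall s \near (1 : R), Im (V (0 + s%:C * z)) =
    (\int[lebesgue_measure]_(t in `[0, 1]) (Im (f ((t * s)%:C * z) * z) * s))%R.
  apply: filterS V1 => s /VE; rewrite add0r => -> /=.
  apply: eq_Rintegral => t _; rewrite scaleE mulrCA.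
  by case: (f _ * z) => ? ? /=; rewrite mul0r addr0 mulrC.
have [_ e1] := near_eq_is_derive eRe dRe; have [_ e2] := near_eq_is_derive eIm dIm.
have [_ e3] := dRe'; have [_ e4] := dIm'.
rewrite -[z in f z]mul1r -(rmorph1 (real_complex R)).
apply/eqP; rewrite eq_complex; apply/andP; split; apply/eqP.
  by rewrite -e1 -e3.
by rewrite -e2 -e4.
Unshelve. all: by end_near. Qed.

End ComplexDerivative.

(** * Polynomials as bounded analytic functions *)

Section DiscPolynomials.
Context {R : realType}.
Local Notation C := R[i].

Lemma discE (z : C) : disc z <-> normc z < 1.
Proof. by rewrite /disc /= Defs.normcE ltcR. Qed.

Lemma disc_ball (a : C) : disc a ->
  exists2 r : R, 0 < r & forall z, normc (z - a) < r -> disc z.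
Proof.
move=> /discE a1; exists (1 - normc a); first by rewrite subr_gt0.
move=> z; rewrite ltrBrDr => za; apply/discE; apply: le_lt_trans za.
by rewrite -[in leLHS](subrK a z) normcD.
Qed.

Lemma nbhs_disc (a : C) : disc a -> nbhs a (disc : set C).
Proof. by move=> /disc_ball[r r0 ra]; apply/nbhscP; exists r. Qed.

Lemma analytic_at_near_eq (f g : C -> C) (a : C) (r : R) : 0 < r ->
  (forall z, normc (z - a) < r -> f z = g z) -> analytic_at f a -> analytic_at g a.
Proof.
move=> r0 fg [c [s [s0 cf]]]; exists c, (Num.min r s).
split=> [|z]; first by rewrite lt_min r0.
rewrite Defs.normcE ltcR lt_min => /andP[zr zs]; rewrite -fg//.
by apply: cf; rewrite Defs.normcE ltcR.
Qed.

(** Composing with ['X + a%:P] recentres the polynomial at [a]; its series is then stationary from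
    the index [size q] on. *)
Lemma analytic_at_horner (p : {poly C}) (a : C) : analytic_at (horner p) a.
Proof.
pose q := p \Po ('X + a%:P); exists (fun n => q`_n), 1; split=> // z _.
have -> : p.[z] = q.[z - a].
  by rewrite horner_comp hornerD hornerX hornerC subrK.
apply: (@cvg_near_cst _ _ (q.[z - a]) _ \oo).
exists (size q) => // n /= qn; rewrite /series /= horner_coef big_mkord.
rewrite (big_ord_widen n (fun i => q`_i * (z - a) ^+ i) qn).
rewrite [LHS](bigID (fun i : 'I_n => (i < size q)%N)) /=.
rewrite [X in _ + X]big1 ?addr0// => i; rewrite -leqNgt => qi.
by rewrite nth_default ?mul0r.
Qed.

Lemma normc_horner_le (p : {poly C}) (z : C) : disc z ->
  normc p.[z] <= \sum_(i < size p) normc p`_i.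
Proof.
move=> /discE z1; rewrite horner_coef; apply: le_trans (normc_sum _ _ _) _.
apply: ler_sum => i _; rewrite normcM normcX ler_piMr ?normc_ge0//.
by rewrite exprn_ile1 ?normc_ge0 ?ltW.
Qed.

Lemma is_derive_horner (p : {poly C}) (z : C) :
  is_derive z 1 (horner p) (p^`()).[z].
Proof.
elim/poly_ind: p => [|p c IH].
  rewrite (_ : horner 0 = cst 0); last by apply/funext => w; rewrite horner0.
  by rewrite deriv0 horner0; exact: is_derive_cst.
rewrite (_ : horner _ = horner p * id + cst c); last first.
  by apply/funext => w; rewrite !fctE !hornerE.
apply: (is_derive_eq (is_deriveD (is_deriveM IH (is_derive_id z 1))
  (is_derive_cst c z 1))).
by rewrite derivD derivM derivX derivC !hornerE /GRing.scale /=; ring.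
Qed.

(** The value 0 off the disc is the normalization imposed by [is_Hinf]. *)
Definition poly_disc (p : {poly C}) (z : C) : C := if `[< disc z >] then p.[z] else 0.

Lemma poly_discE p z : disc z -> poly_disc p z = p.[z].
Proof. by move=> Dz; rewrite /poly_disc asboolT. Qed.

Lemma poly_disc_Hinf p : poly_disc p \in @Hinf_pred R.
Proof.
apply/HinfP; split.
- move=> a /disc_ball[r r0 ra]; apply: (analytic_at_near_eq r0 (f := horner p)).
    by move=> z /ra Dz; rewrite poly_discE.
  exact: analytic_at_horner.
- exists (\sum_(i < size p) normc p`_i) => z Dz.
  by rewrite poly_discE// normc_horner_le.
- by move=> z Dz; rewrite /poly_disc asboolF.
Qed.

Definition Hpoly p : Hinf R := MkHinf (poly_disc_Hinf p).

Lemma derive1_poly_disc p z : disc z -> derive1 (poly_disc p) z = (p^`()).[z].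
Proof.
move=> Dz; rewrite derive1E; apply: derive_val.
apply: near_eq_is_derive (is_derive_horner p z).
by apply: filterS (nbhs_disc Dz) => w /poly_discE ->.
Qed.

End DiscPolynomials.

(** * The Volterra operator *)

Section Volterra.
Context {R : realType}.
Local Notation C := R[i].

Lemma Volterra1 (g f : C -> C) (z : C) : analytic_on disc g ->
  (forall w, disc w -> f w = 1) -> disc z -> Volterra g f z = g z - g 0.
Proof.
move=> ag f1 /discE z1.
have Dt (t : R) : 0 <= t <= 1 -> disc (t%:C * z).
  move=> /andP[t0 t1]; apply/discE; rewrite normcM normcR ger0_norm//.
  by apply: le_lt_trans z1; rewrite ler_piMl ?normc_ge0.
have dg (t : R) : 0 <= t <= 1 -> is_derive (t%:C * z) 1 g (derive1 g (t%:C * z)).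
  by move=> /Dt/ag/analytic_at_derive[].
rewrite -(cintegral01_derive dg); last by move=> t /Dt/ag/analytic_at_derive[].
rewrite /Volterra /cintegral01; congr (_ +i* _); apply: eq_Rintegral => t;
  by rewrite inE /= in_itv /= => /Dt/f1 ->; rewrite mul1r.
Qed.

(** Analyticity of [V] supplies the derivative, and the integrals along rays determine its value. At
    the origin the ray degenerates to a point. *)
Lemma derive1_Volterra (g f V : C -> C) (z : C) :
  analytic_on disc g -> analytic_on disc f -> analytic_on disc V ->
  (forall w, disc w -> V w = Volterra g f w) ->
  disc z -> z != 0 -> derive1 V z = f z * derive1 g z.
Proof.
move=> ag af aV VE Dz z0.
have [dV _ _] := analytic_at_derive (aV _ Dz).
apply: (@cintegral01_scaled_derive _ V (fun w => f w * derive1 g w) _ _ z0 Dz VE _ dV).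
move=> w Dw; have [_ cf _] := analytic_at_derive (af _ Dw).
have [_ _ cg'] := analytic_at_derive (ag _ Dw).
exact: cvgM cf cg'.
Qed.

(** Convexity of balls, used for discs about 0 as well as for balls about a boundary point. *)
Lemma normc_segment_lt (c z w : C) (r t : R) :
  normc (z - c) < r -> normc (w - c) < r -> 0 <= t <= 1 ->
  normc (z + t%:C * (w - z) - c) < r.
Proof.
move=> zc wc /andP[t0 t1].
have -> : z + t%:C * (w - z) - c = (1 - t)%:C * (z - c) + t%:C * (w - c).
  by rewrite rmorphB rmorph1; ring.
apply: le_lt_trans (normcD _ _) _; rewrite !normcM !normcR.
rewrite !ger0_norm ?subr_ge0//.
pose m := Num.max (normc (z - c)) (normc (w - c)).
apply: (@le_lt_trans _ _ m); last by rewrite gt_max zc.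
rewrite (_ : m = (1 - t) * m + t * m); last by ring.
by rewrite lerD// ler_wpM2l ?subr_ge0// /m le_max lexx ?orbT.
Qed.

(* Points within distance 1 of the unit circle are used because a segment
   between two of them avoids 0, where [derive1_Volterra] says nothing. *)
Lemma segment_near_circle (zeta z w : C) (t : R) : normc zeta = 1 ->
  disc z -> disc w -> normc (z - zeta) < 1 -> normc (w - zeta) < 1 ->
  0 <= t <= 1 -> disc (z + t%:C * (w - z)) /\ z + t%:C * (w - z) != 0.
Proof.
move=> zeta1 Dz Dw zz wz t01; split.
  apply/discE; rewrite -[_ + _]subr0; apply: normc_segment_lt => //;
    by rewrite subr0; apply/discE.
apply: contra_ltN (normc_segment_lt zz wz t01) => /eqP ->.
by rewrite sub0r normcN zeta1.
Qed.

Lemma is_derive_Volterra (g f V : C -> C) (z : C) :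
  analytic_on disc g -> analytic_on disc f -> analytic_on disc V ->
  (forall w, disc w -> V w = Volterra g f w) ->
  disc z -> z != 0 -> is_derive z 1 V (f z * derive1 g z).
Proof.
move=> ag af aV VE Dz z0; rewrite -(derive1_Volterra ag af aV VE Dz z0).
by have [] := analytic_at_derive (aV _ Dz).
Qed.

(* [V - f g] is a primitive of [- f' g], hence Lipschitz. *)
Lemma Volterra_oscillation (g f V : C -> C) (zeta z w : C) (G M : R) :
  analytic_on disc g -> analytic_on disc f -> analytic_on disc V ->
  (forall w, disc w -> V w = Volterra g f w) ->
  (forall w, disc w -> normc (g w) <= G) ->
  (forall w, disc w -> normc (derive1 f w) <= M) ->
  normc zeta = 1 -> disc z -> disc w ->
  normc (z - zeta) < 1 -> normc (w - zeta) < 1 ->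
  normc (V w - V z) <=
    2 * (M * G * normc (w - z)) + G * (normc (f z) + normc (f w)).
Proof.
move=> ag af aV VE gG fM zeta1 Dz Dw zz wz.
pose H v := V v - f v * g v.
have dH v : disc v -> v != 0 -> is_derive v 1 H (- (derive1 f v * g v)).
  move=> Dv v0.
  have dV := is_derive_Volterra ag af aV VE Dv v0.
  have [df _ _] := analytic_at_derive (af _ Dv).
  have [dg _ _] := analytic_at_derive (ag _ Dv).
  rewrite (_ : H = V - f * g); last by [].
  apply: (is_derive_eq (is_deriveB dV (is_deriveM df dg))).
  have E (x y s t : C) : x * y - (x * y + s * t) = - (t * s) by ring.
  exact: E.
have HL : normc (H w - H z) <= 2 * (M * G * normc (w - z)).
  apply: (@normc_mean_value _ H (fun v => - (derive1 f v * g v))) => t t01.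
  have [Dp p0] := segment_near_circle zeta1 Dz Dw zz wz t01.
  split; first exact: dH.
  by rewrite normcN normcM ler_pM ?normc_ge0 ?fM ?gG.
(* The increment of [f * g] is bounded by the values of [f] alone: [g] is only known to be bounded,
   but [f] will be small near [zeta]. *)
have -> : V w - V z = (H w - H z) + (f w * g w - f z * g z).
  by rewrite /H; ring.
apply: le_trans (normcD _ _) _; apply: lerD => //.
apply: le_trans (normcD _ _) _; rewrite normcN !normcM addrC mulrDr.
by apply: lerD; rewrite mulrC ler_wpM2r ?normc_ge0// gG.
Qed.

Lemma continuous_normc : continuous (@normc R).
Proof.
move=> z; apply/(@cvgrPdistC_lt _ _ _ (nbhs z)) => e e0.
apply/nbhscP; exists e => // w; apply: le_lt_trans.
have := normcD (w - z) z; have := normcD (z - w) w; rewrite !subrK normcB.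
by rewrite ler_norml => ? ?; apply/andP; split; lra.
Qed.

(* [g'] need not be bounded on the disc, but it is on the segment, by
   compactness. *)
Lemma cvg_Volterra_segment (g : C -> C) (f V : nat -> C -> C)
    (zeta z w : C) (e : nat -> R) :
  analytic_on disc g -> (forall n, analytic_on disc (f n)) ->
  (forall n, analytic_on disc (V n)) ->
  (forall n w, disc w -> V n w = Volterra g (f n) w) ->
  normc zeta = 1 -> disc z -> disc w ->
  normc (z - zeta) < 1 -> normc (w - zeta) < 1 ->
  (forall n (t : R), 0 <= t <= 1 ->
    normc (f n (z + t%:C * (w - z)) - 1) <= e n) ->
  e @ \oo --> (0 : R) ->
  (V n w - V n z) @[n --> \oo] --> g w - g z.
Proof.
move=> ag af aV VE zeta1 Dz Dw zz wz fe e0.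
have seg t (t01 : 0 <= t <= 1) := segment_near_circle zeta1 Dz Dw zz wz t01.
have [B B0 gB] : exists2 B : R, 0 <= B & forall t : R, 0 <= t <= 1 ->
    normc (derive1 g (z + t%:C * (w - z))) <= B.
  have [|c _ cmax] := @EVT_max R
      (fun t => normc (derive1 g (z + t%:C * (w - z)))) 0 1 ler01.
    apply/continuous_in_subspaceT => t; rewrite inE /= in_itv /= => /seg[Dt _].
    have [_ _ cg'] := analytic_at_derive (ag _ Dt).
    have c1 : {for t, continuous (fun t : R => z + t%:C * (w - z))}.
      by apply: cvgD; [exact: cvg_cst|exact: continuous_scale_line].
    have c2 : {for t, continuous (fun t : R => derive1 g (z + t%:C * (w - z)))}.
      exact: (@continuous_comp _ _ _ (fun t : R => z + t%:C * (w - z)) (derive1 g) t c1 cg').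
    exact: (@continuous_comp _ _ _ (fun t : R => derive1 g (z + t%:C * (w - z)))
       (@normc R : C -> R) t c2 (@continuous_normc _)).
  exists (normc (derive1 g (z + c%:C * (w - z)))); first exact: normc_ge0.
  by move=> t t01; apply: cmax; rewrite in_itv.
(* [V n - g] is a primitive of [(f n - 1) * derive1 g], which is at most [e n * B] in modulus on the
   segment. *)
have H n : normc (V n w - V n z - (g w - g z)) <= 2 * (e n * B * normc (w - z)).
  rewrite (_ : V n w - V n z - (g w - g z) = (V n - g) w - (V n - g) z); last first.
    by rewrite !fctE; ring.
  apply: (@normc_mean_value _ (V n - g) (fun v => (f n v - 1) * derive1 g v)) => t t01.
  have [Dp p0] := seg _ t01; split.
    have dV := is_derive_Volterra ag (af n) (aV n) (VE n) Dp p0.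
    have [dg _ _] := analytic_at_derive (ag _ Dp).
    apply: (is_derive_eq (is_deriveB dV dg)).
    by rewrite mulrBl mul1r.
  by rewrite normcM ler_pM ?normc_ge0 ?fe ?gB.
have e0' : (2 * (e n * B * normc (w - z))) @[n --> \oo] --> (0 : R).
  have -> : (0 : R) = 2 * (0 * B * normc (w - z)) by rewrite !mul0r mulr0.
  apply: cvgM; first exact: cvg_cst.
  apply: cvgM; last exact: cvg_cst.
  by apply: cvgM; last exact: cvg_cst.
apply/cvgcP => d d0; have e0'' := cvgr_lt 0 e0' d d0.
near=> n; apply: le_lt_trans (H n) _; near: n; exact: e0''.
Unshelve. all: by end_near. Qed.

End Volterra.

(** * Functionals on bounded analytic functions *)

(** A weak cluster point of the image sequence is the weak limit of a finer filter. Functionals are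
    weakly continuous, so any limit of [l] along the sequence must be its value at that point. *)
Lemma weakly_compact_cluster (K : numFieldType) (V W : normedModType K)
    (T : V -> W) (x : nat -> V) :
  weakly_compact T -> bounded_set (range x) ->
  exists y : W, forall (l : dual W) (c : K),
    sval l (T (x n)) @[n --> \oo] --> c -> sval l y = c.
Proof.
move=> wT bx; have [A TA [cA _]] := wT _ bx.
pose F : set_system (weak W) := (T \o x : nat -> weak W) @ \oo.
have FA : F A by apply: (@filterE nat \oo) => n; apply: TA; exists (x n) => //; exists n.
have [y [_]] := cA F _ FA; rewrite cluster_cvgE => -[G GG [Gy FG]].
exists y => l c lc; have Gl : sval l @ G --> sval l y.
  have /cvg_sup/(_ l) Gl := Gy.
  exact: (cvg_comp _ _ Gl (@initial_continuous _ _ (sval l) y)).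
apply: (cvg_unique (@norm_hausdorff _ K) Gl).
by apply: cvg_trans lc => P lP; exact: (FG (sval l @^-1` P) lP).
Qed.

Section HinfDual.
Context {R : realType}.
Local Notation C := R[i].
Local Notation norm h := (sup [set normc (h z) | z in disc]).

Lemma Hinf_fun_lin (a : C) (u v : Hinf R) z : (a *: u + v) z = a * u z + v z.
Proof. by []. Qed.

Lemma Hinf_analytic (h : Hinf R) : analytic_on disc h.
Proof. by have [] := HinfP _ (valP h). Qed.

Lemma Hinf_functional_continuous (l : Hinf R -> C) (B : R) :
  scalar l -> (forall h : Hinf R, normc (l h) <= B * norm h) -> continuous l.
Proof.
move=> lin lB h0.
apply: (@cvgcP R (Hinf R) (nbhs h0) l (l h0) _).2 => e e0.
have B1 : 0 < `|B| + 1 by rewrite ltr_wpDl.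
have d0 : 0 < (e / (`|B| + 1))%:C :> C by rewrite ltcE /= eqxx divr_gt0.
have nd := @cvgr_distC_lt _ _ _ (nbhs h0) _ id h0 cvg_id _ d0.
 near=> h; have : `|h - h0| < (e / (`|B| + 1))%:C by near: h; exact: nd.
 rewrite [X in X < _]/(norm (h - h0))%:C ltcR => hd.
have -> : l h - l h0 = l (h - h0).
  by have := lin 1 (h - h0) h0; rewrite scale1r subrK mul1r => ->; rewrite addrK.
apply: le_lt_trans (lB _) _.
have n0 : 0 <= norm (h - h0) := le_trans (normc_ge0 _) (Hinf_le_sup _ (disc0 R)).
apply: (@le_lt_trans _ _ ((`|B| + 1) * norm (h - h0))).
  by rewrite ler_wpM2r// (le_trans (ler_norm B))// lerDl.
by rewrite mulrC -ltr_pdivlMr.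
Unshelve. all: by end_near. Qed.

Lemma Hinf_dual (l : Hinf R -> C) (B : R) :
  scalar l -> (forall h : Hinf R, normc (l h) <= B * norm h) ->
  exists l' : dual (Hinf R), sval l' = l.
Proof.
move=> lin lB.
by exists (exist _ l (conj lin (Hinf_functional_continuous lin lB))).
Qed.

(** Differences of point evaluations identify a weak cluster point up to an additive constant. *)
Lemma Hinf_diff_dual (z w : C) : disc z -> disc w ->
  exists l : dual (Hinf R), forall h : Hinf R, sval l h = h w - h z.
Proof.
move=> Dz Dw; have [|h|l lE] := @Hinf_dual (fun h => h w - h z) 2.
- by move=> a u v; rewrite !Hinf_fun_lin; ring.
- rewrite mulr_natl mulr2n; apply: le_trans (normcD _ _) _.
  by rewrite normcN lerD// Hinf_le_sup.
- by exists l => h; rewrite lE.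
Qed.

(** For arbitrary [h] the differences need not converge along [\oo], but they are bounded by twice
    the norm of [h], so their limit along [U] exists; uniqueness of limits makes it linear. *)
Lemma Hinf_ultra_dual (U : set_system nat) (z w : nat -> C) : UltraFilter U ->
  (forall n, disc (z n)) -> (forall n, disc (w n)) ->
  exists l : dual (Hinf R), forall h : Hinf R,
    h (w n) - h (z n) @[n --> U] --> sval l h.
Proof.
move=> UU Dz Dw.
have hb (h : Hinf R) n : normc (h (w n) - h (z n)) <= 2 * norm h.
  rewrite mulr_natl mulr2n; apply: le_trans (normcD _ _) _.
  by rewrite normcN lerD// Hinf_le_sup.
have [l lP] := choice (fun h : Hinf R => ultra_bounded_cvg UU (hb h)).
have PU : ProperFilter U := @ultra_proper _ _ UU.
have [|h|l' l'E] := @Hinf_dual l 2.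
- move=> a u v; apply: (cvg_unique (@norm_hausdorff _ C) (lP (a *: u + v))).
  rewrite (_ : (fun n => _) = fun n => a * (u (w n) - u (z n)) + (v (w n) - v (z n))).
    by apply: cvgD; [apply: cvgM; [exact: cvg_cst|exact: lP]|exact: lP].
  by apply/funext => n; rewrite !Hinf_fun_lin; ring.
- apply: (@cvg_normc_le _ _ U UU (fun n => h (w n) - h (z n)) _ _ (lP h)).
  by apply: (@filterE _ U) => n; exact: hb.
- by exists l' => h; rewrite l'E.
Qed.

End HinfDual.

(** * Boundary behaviour of the symbol *)

Section Peak.
Context {R : realType}.
Local Notation C := R[i].
Context (zeta : C) (zeta1 : normc zeta = 1).

(** The classical peak function at [zeta]: on the closed disc its modulus equals 1 only at
    [zeta]. *)
Definition half_turn : {poly C} := (2^-1)%:P + (zeta^-1 / 2)%:P * 'X.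

Lemma half_turnE z : half_turn.[z] = (1 + zeta^-1 * z) / 2.
Proof. by rewrite /half_turn !hornerE; ring. Qed.

(** The bound depends on [normc z] alone and is below 1 in the disc, so the powers decay
    geometrically on each smaller concentric disc. *)
Lemma normc_half_turn_le z : normc half_turn.[z] <= (1 + normc z) / 2.
Proof.
rewrite half_turnE normcM normcV normcn ler_wpM2r ?invr_ge0//.
apply: le_trans (normcD _ _) _.
by rewrite normc1 normcM normcV zeta1 invr1 mul1r.
Qed.

Lemma half_turn_zeta : half_turn.[zeta] = 1.
Proof.
have z0 : zeta != 0.
  by apply/eqP => z0; have := zeta1; rewrite z0 normc0 => /eqP; rewrite eq_sym oner_eq0.
by rewrite half_turnE mulVf//; field.
Qed.

Definition antipeak n : {poly C} := 1 - half_turn ^+ n.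

Lemma antipeakE n z : (antipeak n).[z] = 1 - half_turn.[z] ^+ n.
Proof. by rewrite /antipeak hornerD hornerN hornerC horner_exp. Qed.

Lemma normc_antipeak_le n z : disc z -> normc (antipeak n).[z] <= 2.
Proof.
move=> /discE z1; rewrite antipeakE; apply: le_trans (normcD _ _) _.
rewrite normcN normc1 normcX.
have h : normc half_turn.[z] <= 1.
  by apply: le_trans (normc_half_turn_le z) _; lra.
have : normc half_turn.[z] ^+ n <= 1 by rewrite exprn_ile1 ?normc_ge0.
lra.
Qed.

Lemma antipeak_cvg_zeta n (z : nat -> C) : z k @[k --> \oo] --> zeta ->
  (antipeak n).[z k] @[k --> \oo] --> (0 : C).
Proof.
move=> zk; have [dp _] := is_derive_horner (antipeak n) zeta.
have c : {for zeta, continuous (horner (antipeak n))}.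
  by apply: differentiable_continuous; apply/derivable1_diffP.
have -> : (0 : C) = (antipeak n).[zeta].
  by rewrite antipeakE half_turn_zeta expr1n subrr.
exact: cvg_comp zk c.
Qed.

Lemma bounded_antipeak : bounded_set (range (fun n => Hpoly (antipeak n))).
Proof.
exists (2 : R)%:C; split; first by apply/complex_realP; exists 2.
move=> M M2 _ [n _ <-] /=; apply: le_trans (ltW M2).
rewrite [leLHS]/(Hinf_norm _) lecR; apply: Hinf_sup_le => z Dz /=.
by rewrite poly_discE// normc_antipeak_le.
Qed.

End Peak.

(** * Oscillation of the symbol near a point of the closed disc *)

Section BoundaryOscillation.
Context {R : realType}.
Local Notation C := R[i].
Context (g : C -> C) (T : Hinf R -> Hinf R) (ag : analytic_on disc g).
Context (TE : forall (f : Hinf R) z, disc z -> T f z = Volterra g f z).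

Lemma symbol_bounded : exists G : R, forall z, disc z -> normc (g z) <= G.
Proof.
have [_ [M TM] _] := HinfP _ (valP (T (Hpoly 1))).
exists (M + normc (g 0)) => z Dz.
rewrite -(subrK (g 0) (g z)); apply: le_trans (normcD _ _) _; rewrite lerD2r.
rewrite -(@Volterra1 _ g (Hpoly 1))//; last first.
  by move=> w Dw; rewrite /= poly_discE// hornerC.
by rewrite -TE// TM.
Qed.

(** The bound of [Volterra_oscillation] tends to 0, because both sequences approach [zeta], where
    [antipeak] vanishes. Its constant [M] depends on [n], which is fixed here. *)
Lemma antipeak_image_cvg (zeta : C) n (z w : nat -> C) : normc zeta = 1 ->
  (forall k, disc (z k)) -> (forall k, disc (w k)) ->
  z k @[k --> \oo] --> zeta -> w k @[k --> \oo] --> zeta ->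
  T (Hpoly (antipeak zeta n)) (w k) - T (Hpoly (antipeak zeta n)) (z k)
    @[k --> \oo] --> (0 : C).
Proof.
move=> zeta1 Dz Dw zk wk; set f := Hpoly _.
have [G gG] := symbol_bounded.
pose M : R := \sum_(i < size (antipeak zeta n)^`()) normc (antipeak zeta n)^`()`_i.
have fM v : disc v -> normc (derive1 f v) <= M.
  by move=> Dv; rewrite derive1_poly_disc// normc_horner_le.
have osc k : normc (z k - zeta) < 1 -> normc (w k - zeta) < 1 ->
    normc (T f (w k) - T f (z k)) <=
    2 * (M * G * normc (w k - z k)) + G * (normc (f (z k)) + normc (f (w k))).
  move=> zk1 wk1.
  exact: (@Volterra_oscillation _ g f (T f) zeta (z k) (w k) G M ag
    (Hinf_analytic f) (Hinf_analytic (T f)) (TE f) gG fM zeta1 (Dz k) (Dw k) zk1 wk1).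
have fE v : disc v -> f v = (antipeak zeta n).[v] by exact: poly_discE.
have cn (v : nat -> C) : v k @[k --> \oo] --> (0 : C) -> normc (v k) @[k --> \oo] --> (0 : R).
  move=> v0; rewrite -(@normc0 R); apply: cvg_comp v0 _; exact: continuous_normc.
have b0 : 2 * (M * G * normc (w k - z k)) + G * (normc (f (z k)) + normc (f (w k)))
    @[k --> \oo] --> (0 : R).
  have -> : (0 : R) = 2 * (M * G * 0) + G * (0 + 0) by rewrite addr0 !mulr0 addr0.
  apply: cvgD.
    apply: cvgM; first exact: cvg_cst.
    apply: cvgM; first exact: cvg_cst.
    by apply: cn; rewrite -(subrr zeta); apply: cvgB.
  apply: cvgM; first exact: cvg_cst.
  apply: cvgD; apply: cn; under eq_fun do rewrite fE//;
    exact: antipeak_cvg_zeta.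
apply/cvgcP => e e0.
have z1 := (cvgcP _ _ _).1 zk 1 ltr01; have w1 := (cvgcP _ _ _).1 wk 1 ltr01.
have b0' := cvgr_lt 0 b0 e e0.
near=> k; rewrite subr0; apply: le_lt_trans (osc k _ _) _; near: k.
- exact: z1.
- exact: w1.
- exact: b0'.
Unshelve. all: by end_near. Qed.

Context (wcT : weakly_compact T).

(** On a segment inside the disc [antipeak] tends to 1 uniformly, so the increments of the images
    tend to those of [g]; the functionals of [Hinf_diff_dual] transfer this to the cluster point
    [h]. *)
Lemma antipeak_weak_limit (zeta : C) : normc zeta = 1 ->
  exists h : Hinf R,
    (forall (l : dual (Hinf R)) (c : C),
       sval l (T (Hpoly (antipeak zeta n))) @[n --> \oo] --> c -> sval l h = c) /\
    (forall z w, disc z -> disc w -> normc (z - zeta) < 1 ->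
       normc (w - zeta) < 1 -> h w - h z = g w - g z).
Proof.
move=> zeta1.
have [h hl] := weakly_compact_cluster wcT (bounded_antipeak zeta1).
exists h; split=> // z w Dz Dw zz wz.
have [l lE] := Hinf_diff_dual Dz Dw; rewrite -lE; apply: hl.
under eq_fun do rewrite lE.
(* The strict inequality in [normc_segment_lt] asks for a radius [m'] strictly between [m] and 1;
   then [normc_half_turn_le] gives the ratio [r < 1] on the whole segment. *)
pose m := Num.max (normc z) (normc w); pose m' := (1 + m) / 2.
have m1 : m < 1 by rewrite gt_max; apply/andP; split; exact/discE.
have m0 : 0 <= m by rewrite le_max normc_ge0.
have m'1 : m' < 1 by rewrite /m'; lra.
have mm' : m < m' by rewrite /m'; lra.
pose r := (1 + m') / 2.
apply: (@cvg_Volterra_segment _ g (fun n => Hpoly (antipeak zeta n))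
  (fun n => T (Hpoly (antipeak zeta n))) zeta z w (fun n => r ^+ n) ag
  (fun n => Hinf_analytic _) (fun n => Hinf_analytic _) (fun n => TE _)
  zeta1 Dz Dw zz wz).
- move=> n t t01; have [Dp _] := segment_near_circle zeta1 Dz Dw zz wz t01.
  rewrite /= poly_discE// antipeakE addrAC subrr add0r normcN normcX.
  rewrite lerXn2r ?nnegrE ?normc_ge0//; first by rewrite /r; lra.
  apply: le_trans (normc_half_turn_le zeta1 _) _.
  rewrite ler_wpM2r ?invr_ge0// lerD2l ltW// -[_ + _]subr0.
  by apply: normc_segment_lt => //; rewrite subr0; apply: le_lt_trans mm';
     rewrite le_max lexx ?orbT.
- by apply: cvg_expr; rewrite ger0_norm /r; lra.
Qed.

(** Otherwise two sequences tending to [zeta] keep the values of [g] at distance at least [e]. Their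
    ultrafilter functional kills every image of an antipeak, hence also [h], although [h] has the
    increments of [g] near [zeta]. *)
Lemma symbol_boundary_cauchy (zeta : C) (e : R) : normc zeta = 1 -> 0 < e ->
  exists2 d : R, 0 < d & forall z w, disc z -> disc w ->
    normc (z - zeta) < d -> normc (w - zeta) < d -> normc (g w - g z) < e.
Proof.
move=> zeta1 e0; apply: contrapT => Nd.
have /choice[zw zwP] n : exists p : C * C, [/\ disc p.1, disc p.2,
    normc (p.1 - zeta) < n.+1%:R^-1, normc (p.2 - zeta) < n.+1%:R^-1 &
    e <= normc (g p.2 - g p.1)].
  apply: contrapT => Np; apply: Nd; exists n.+1%:R^-1; first by rewrite invr_gt0.
  move=> z w Dz Dw zn wn; rewrite ltNge; apply/negP => ez.
  by apply: Np; exists (z, w).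
pose z n := (zw n).1; pose w n := (zw n).2.
have Dz n : disc (z n) by have [] := zwP n.
have Dw n : disc (w n) by have [] := zwP n.
have cvg_zeta (v : nat -> C) : (forall n, normc (v n - zeta) < n.+1%:R^-1) ->
    v n @[n --> \oo] --> zeta.
  move=> vn; apply/cvgcP => d d0.
  have hn := cvgr_lt 0 (@cvg_harmonic R) d d0.
  by near=> n; apply: lt_trans (vn n) _; near: n; exact: hn.
have zk : z n @[n --> \oo] --> zeta by apply: cvg_zeta => n; have [] := zwP n.
have wk : w n @[n --> \oo] --> zeta by apply: cvg_zeta => n; have [] := zwP n.
have [U [UU Uoo]] := @ultraFilterLemma nat \oo _.
have PU : ProperFilter U := @ultra_proper _ _ UU.
have [l lP] := Hinf_ultra_dual UU Dz Dw.
have [h [hl hg]] := antipeak_weak_limit zeta1.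
have lT n : sval l (T (Hpoly (antipeak zeta n))) = 0.
  apply: (cvg_unique (@norm_hausdorff _ C) (lP _)).
  move=> P P0; apply: Uoo; exact: (antipeak_image_cvg n zeta1 Dz Dw zk wk P0).
have lh : sval l h = 0.
  by apply: hl; under eq_fun do rewrite lT; exact: cvg_cst.
have := lP h; rewrite lh => /cvgcP/(_ _ e0) lt_e.
(* The increments of [h] and [g] are known to agree only within distance 1 of [zeta], so an index
   must satisfy both bounds besides [lt_e]. *)
have z1 := Uoo _ ((@cvgcP _ _ \oo z zeta eventually_filter).1 zk 1 ltr01).
have w1 := Uoo _ ((@cvgcP _ _ \oo w zeta eventually_filter).1 wk 1 ltr01).
have [n [[zn wn]]] := @filter_ex _ U _ _ (filterI (filterI z1 w1) lt_e).
rewrite subr0 hg// ltNge; have [_ _ _ _ ->] // := zwP n.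
Unshelve. all: by end_near. Qed.

(** At interior points continuity of [g] gives the same condition, so the extension can treat all
    points of the closed disc uniformly. *)
Lemma symbol_cauchy (zeta : C) (e : R) : normc zeta <= 1 -> 0 < e ->
  exists2 d : R, 0 < d & forall z w, disc z -> disc w ->
    normc (z - zeta) < d -> normc (w - zeta) < d -> normc (g w - g z) < e.
Proof.
rewrite le_eqVlt => /predU1P[|/discE Dz] e0; first exact: symbol_boundary_cauchy.
have [_ cg _] := analytic_at_derive (ag Dz).
have e2 : 0 < e / 2 by rewrite divr_gt0.
have /nbhscP[d d0 dP] : \forall z \near zeta, normc (g z - g zeta) < e / 2.
  exact: ((@cvgcP _ _ (nbhs zeta) g (g zeta) (nbhs_filter zeta)).1 cg _ e2).
exists d => // z w _ _ /dP gz /dP gw.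
rewrite (_ : g w - g z = (g w - g zeta) - (g z - g zeta)); last by ring.
by apply: le_lt_trans (normcD _ _) _; rewrite normcN (splitr e) ltrD.
Qed.

End BoundaryOscillation.

(** * Continuous extension to the closed disc *)

Section BoundaryExtension.
Context {R : realType}.
Local Notation C := R[i].

Lemma closure_disc_le1 (z : C) : closure disc z -> normc z <= 1.
Proof.
move=> cz; apply/ler_addgt0Pr => e e0.
have [|w [/discE w1 wz]] := cz (fun w => normc (w - z) < e).
  by apply/nbhscP; exists e.
rewrite -(subrK w z); apply: le_trans (normcD _ _) _.
by rewrite addrC normcB lerD// ltW.
Qed.

(** The real factor is below 1, so even a point of the circle is approached from inside the disc. *)
Definition radial (z : C) (k : nat) : C := (1 - k.+1%:R^-1 : R)%:C * z.

Lemma radial_disc z k : normc z <= 1 -> disc (radial z k).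
Proof.
move=> z1; apply/discE; rewrite normcM normcR ger0_norm; last first.
  by rewrite subr_ge0 invf_le1// ler1n.
have k0 : 0 < k.+1%:R^-1 :> R by rewrite invr_gt0.
apply: le_lt_trans (_ : 1 - k.+1%:R^-1 < 1); last by rewrite gtrBl.
by rewrite ler_piMr// subr_ge0 invf_le1// ler1n.
Qed.

Lemma cvg_radial z : radial z k @[k --> \oo] --> z.
Proof.
apply/cvgcP => d d0.
have z0 : 0 < d / (normc z + 1) by rewrite divr_gt0// ltr_wpDl ?normc_ge0.
have hn := cvgr_lt 0 (@cvg_harmonic R) _ z0.
near=> k; rewrite /radial rmorphB rmorph1 mulrBl mul1r addrAC subrr add0r normcN.
rewrite normcM normcR ger0_norm ?invr_ge0//.
have : k.+1%:R^-1 < d / (normc z + 1) by near: k; exact: hn.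
rewrite ltr_pdivlMr ?ltr_wpDl ?normc_ge0//; apply: le_lt_trans.
by rewrite ler_wpM2l ?invr_ge0// lerDl.
Unshelve. all: by end_near. Qed.

(** Boundedness provides an ultrafilter limit of [g] along each radial sequence; the Cauchy
    condition makes these limits vary continuously and agree with [g] inside. *)
Lemma continuous_extension (g : C -> C) (G : R) :
  (forall z, disc z -> normc (g z) <= G) ->
  (forall zeta (e : R), normc zeta <= 1 -> 0 < e ->
    exists2 d : R, 0 < d & forall z w, disc z -> disc w ->
      normc (z - zeta) < d -> normc (w - zeta) < d -> normc (g w - g z) < e) ->
  exists G' : C -> C, {within closure disc, continuous G'} /\
    forall z, disc z -> G' z = g z.
Proof.
move=> gG cg.
have [U [UU Uoo]] := @ultraFilterLemma nat \oo _.
have PU : ProperFilter U := @ultra_proper _ _ UU.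
have /choice[L LP] z : exists l : C, normc z <= 1 ->
    g (radial z k) @[k --> U] --> l.
  have [z1|] := boolP (normc z <= 1); last by exists 0.
  have [l lP] := ultra_bounded_cvg UU (fun k => gG _ (radial_disc k z1)).
  by exists l.
have rU z (d : R) : 0 < d -> U [set k | normc (radial z k - z) < d].
  move=> d0; apply: Uoo.
  exact: ((@cvgcP _ _ \oo (radial z) z eventually_filter).1 (@cvg_radial z) d d0).
(* A bound on [g v - g w] for all [v] near [z] passes to the limit at [z], with [<] weakened to
   [<=]. *)
have gL z w (e d : R) : normc z <= 1 -> disc w -> 0 < d ->
    (forall v, disc v -> normc (v - z) < d -> normc (g v - g w) < e) ->
    normc (L z - g w) <= e.
  move=> z1 Dw d0 H.
  have c : g (radial z k) - g w @[k --> U] --> L z - g w.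
    by apply: cvgB; [exact: LP|exact: cvg_cst].
  apply: (@cvg_normc_le _ _ U UU (fun k => g (radial z k) - g w) _ _ c).
  apply: filterS (rU z d d0) => k kd; apply/ltW/H => //; exact: radial_disc.
exists L; split.
  apply/subspace_continuousP => z /closure_disc_le1 z1.
  apply/cvgcP => e e0; rewrite near_withinE.
  have e3 : 0 < e / 3 by rewrite divr_gt0.
  have [d d0 H] := cg z (e / 3) z1 e3.
  have d2 : 0 < d / 2 by rewrite divr_gt0.
  (* Halving [d] puts the ball of radius [d / 2] about [w] inside the ball of radius [d] about [z].
     Both limits are then compared with [g v] at one interior point [v] near [z]. *)
  apply/nbhscP; exists (d / 2) => // w wd /closure_disc_le1 w1.
  have [k kd] := filter_ex (rU z d d0); set v := radial z k in kd.
  have Dv : disc v by exact: radial_disc.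
  have Lw : normc (L w - g v) <= e / 3.
    apply: (gL w v _ (d / 2)) => // x Dx xw; apply: H => //.
    rewrite -(subrK w x) -addrA (splitr d).
    by apply: le_lt_trans (normcD _ _) _; rewrite ltrD.
  have Lz : normc (L z - g v) <= e / 3.
    by apply: (gL z v _ d) => // x Dx xz; apply: H.
  rewrite (_ : L w - L z = (L w - g v) - (L z - g v)); last by ring.
  by apply: le_lt_trans (normcD _ _) _; rewrite normcN; lra.
move=> z Dz; apply/eqP; rewrite -subr_eq0; apply/eqP/eq0_normc/eqP.
rewrite eq_le normc_ge0 andbT; apply/ler_addgt0Pr => e e0; rewrite add0r.
have z1 : normc z <= 1 by apply/ltW/discE.
have [d d0 H] := cg z e z1 e0.
(* Inside the disc [z] itself serves as the reference point, so [L z] is within every [e] of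
   [g z]. *)
apply: (gL z z e d) => // v Dv vd.
by apply: H => //; rewrite subrr normc0.
Qed.

End BoundaryExtension.

Theorem theorem1p4 (R : realType) (g : R[i] -> R[i])
  (g_analytic : analytic_on disc g)
  (T : Hinf R -> Hinf R)
  (T_def : forall (f : Hinf R) (z : R[i]), disc z -> T f z = Volterra g f z)
  (T_weakly_compact : weakly_compact T) :
  disc_algebra g.
Proof.
split; first exact: g_analytic.
have [G gG] := symbol_bounded g_analytic T_def.
apply: (continuous_extension gG) => zeta e.
exact: (symbol_cauchy g_analytic T_def T_weakly_compact).
Qed.
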